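(* Let $p$ and $q$ be univariate polynomials with complex coefficients such that $p$ is not a constant multiple of $q$ (i.e., there is no $c \in \mathbb{C}$ with $p = c\,q$). Then the polynomials $P(z,\overline{z}) = p(z)\overline{q(z)} - 1$ and $Q(z,\overline{z}) = \overline{p(z)}\,q(z) - 1$, viewed as bivariate polynomials in $z,\overline{z}$, are coprime.
   Context: Viewing an expression as a bivariate polynomial in $z,\overline{z}$ means treating $z$ and $\overline{z}$ formally as two independent variables $z_1 = z$, $z_2=\overline{z}$. Thus, if $p(z)=\sum_k p_k z^k$ and $q(z)=\sum_k q_k z^k$, then $P(z_1,z_2) = \left(\sum_k p_k z_1^k\right)\left(\sum_k \overline{q_k}\, z_2^k\right) - 1$ and $Q(z_1,z_2) = \left(\sum_k \overline{p_k}\, z_2^k\right)\left(\sum_k q_k z_1^k\right) - 1$ in $\mathbb{C}[z_1,z_2]$. Two polynomials $P,Q\in\mathbb{C}[z_1,z_2]$ are coprime if their greatest common factor has degree zero, i.e., whenever $P = C P_1$ and $Q = C Q_1$ with $C,P_1,Q_1 \in \mathbb{C}[z_1,z_2]$, then $\deg C = 0$ (so $C$ is a nonzero constant). *)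

(* Defs.v *)
From mathcomp Require Import all_boot all_order all_algebra.
From mathcomp Require Import reals.
From mathcomp Require Import complex.
From mathcomp Require Import mpoly.

Set Implicit Arguments.
Unset Strict Implicit.
Unset Printing Implicit Defensive.

Import Order.TTheory GRing.Theory Num.Theory.
Local Open Scope ring_scope.

(* The bivariate ring C[z_1, z_2] is {mpoly R[i][2]}: index 0 is z_1 = z and
   index 1 is z_2, the formal counterpart of the conjugate of z. *)

Definition poly_z (R : realType) (p : {poly R[i]}) : {mpoly R[i][2]} :=
  \sum_(k < size p) p`_k *: 'X_(0 : 'I_2) ^+ k.

Definition poly_zbar (R : realType) (p : {poly R[i]}) : {mpoly R[i][2]} :=
  \sum_(k < size p) (p`_k)^* *: 'X_(1 : 'I_2) ^+ k.

(* msize is the total degree plus one, and msize 0 = 0, so that msize D = 1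
   says that D is a nonzero constant. *)
Definition mcoprime (R : realType) (P Q : {mpoly R[i][2]}) : Prop :=
  forall D P1 Q1 : {mpoly R[i][2]},
    P = D * P1 -> Q = D * Q1 -> msize D = 1%N.

(* Main.v *)
Require Import Defs.
From HB Require Import structures.
From mathcomp Require Import all_boot all_order all_algebra.
From mathcomp Require Import reals.
From mathcomp Require Import complex.
From mathcomp Require Import mpoly.

Set Implicit Arguments.
Unset Strict Implicit.
Unset Printing Implicit Defensive.

Import Order.TTheory GRing.Theory Num.Theory.
Local Open Scope ring_scope.

(** Let D be a common factor of P and Q, and write p', q' for the polynomials
    with conjugated coefficients.  At every zero (z, w) of D in C^2,

      p(z) q'(w) = 1   and   q(z) p'(w) = 1.

    Suppose that D is not a nonzero constant.  Then its zero set contains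
    either a whole line z = x, or a point (z, w) above all but finitely many z
    ([bipoly_zeros]).

    In the second case put a = deg p = deg p' and b = deg q = deg q'.  While z
    stays bounded, p'(w)^b / q'(w)^a stays bounded: for large w because
    numerator and denominator both have degree ab, and for bounded w because
    q'(w) = 1 / p(z) stays away from 0 ([ratio_bound]).  By the two equations
    this quotient is p(z)^a / q(z)^b, so p^a / q^b is a rational function
    without poles, i.e. q^b divides p^a ([dvdp_of_bound], [dvdp_of_curve]).
    Exchanging p and q, p^a divides q^b as well.  So p^a and q^b are
    associate, a^2 = b^2, hence a = b, and p is a constant multiple of q
    ([proportional_of_curve]).

    In the first case the same argument applies to p' and q' as functions of
    w, the companion point being x for every w.

    The zeros of D are found in C[z][w], to which C[z_1, z_2] is carried by
    the injective ring morphism [to_bipoly]. *)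

(** * Growth of univariate polynomials *)

Lemma poly_bounded_on_disc (C : numDomainType) (f : {poly C}) (B : C) :
  0 <= B -> exists2 M, 0 <= M & forall z, `|z| <= B -> `|f.[z]| <= M.
Proof.
move=> B0; elim/poly_ind: f => [|f c [M M0 HM]].
  by exists 0 => // z _; rewrite horner0 normr0.
exists (M * B + `|c|) => [|z zB]; first by rewrite addr_ge0 ?mulr_ge0.
rewrite hornerMXaddC (le_trans (ler_normD _ _)) // lerD2r normrM.
by rewrite ler_pM // HM.
Qed.

Lemma poly_growth_le (C : numDomainType) (f : {poly C}) :
  exists2 M, 0 <= M &
    forall w, 1 <= `|w| -> `|f.[w]| <= M * `|w| ^+ (size f).-1.
Proof.
exists (\sum_(i < size f) `|f`_i|) => [|w w1]; first exact: sumr_ge0.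
rewrite horner_coef (le_trans (ler_norm_sum _ _ _)) // mulr_suml.
apply: ler_sum => i _; rewrite normrM normrX ler_wpM2l //.
by rewrite ler_weXn2l // -ltnS (leq_trans (ltn_ord i)) // leqSpred.
Qed.

Lemma poly_growth_ge (C : numFieldType) (f : {poly C}) : f != 0 ->
  exists W K, [/\ 1 <= W, 0 <= K &
    forall w, W <= `|w| -> `|w| ^+ (size f).-1 <= K * `|f.[w]|].
Proof.
elim/poly_ind: f => [|f c IH]; first by rewrite eqxx.
rewrite -size_poly_eq0 size_MXaddC; have [-> /=|f0 _] := eqVneq f 0.
  rewrite size_poly0; have [_ //|c0 _] := eqVneq c 0.
  exists 1, `|c|^-1; split=> // [|w _]; first by rewrite invr_ge0.
  by rewrite /= expr0 mul0r add0r hornerC mulVf // normr_eq0.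
have [W [K [W1 K0 HK]]] := IH f0.
have W0 : 0 <= W by exact: le_trans W1.
have Kc0 : 0 <= 2 * (K * `|c|) by rewrite !mulr_ge0.
(* From this radius on, K |c| is at most half of |w|^(size f), so that adding
   the constant c costs a factor 2. *)
exists (W + 2 * (K * `|c|)), (2 * K); split=> [||w wW].
- by rewrite (le_trans W1) // lerDl.
- by rewrite mulr_ge0.
have w1 : 1 <= `|w| by rewrite (le_trans W1) // (le_trans _ wW) // lerDl.
have sf : (size f > 0)%N by rewrite size_poly_gt0.
have hw : `|w| ^+ size f <= K * `|(f * 'X + c%:P).[w]| + K * `|c|.
  rewrite -(prednK sf) exprSr -mulrDr.
  apply: (@le_trans _ _ (K * `|f.[w]| * `|w|)).
    by rewrite ler_wpM2r // HK // (le_trans _ wW) // lerDl.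
  rewrite -mulrA ler_wpM2l // -normrM hornerMXaddC.
  by rewrite -[X in `|X|](addrK c) (le_trans (ler_normD _ _)) // normrN.
have hc : 2 * (K * `|c|) <= `|w| ^+ size f.
  apply: (@le_trans _ _ `|w|).
    by apply: le_trans wW; rewrite lerDr.
  by rewrite -[X in X <= _]expr1 ler_weXn2l.
rewrite /= -(lerD2r (`|w| ^+ size f)) -mulrA.
rewrite -mulr2n -[X in X <= _]mulr_natl (le_trans (ler_wpM2l _ hw)) // mulrDr.
by rewrite lerD2l.
Qed.

(** The exponents give f^(deg g) and g^(deg f) the same degree, which controls
    their quotient for large w; the hypothesis on y keeps g(w) away from 0,
    which controls it for bounded w. *)
Lemma ratio_bound (C : numFieldType) (f g : {poly C}) (B : C) :
  g != 0 -> 0 <= B ->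
  exists2 M, 0 <= M & forall y w, `|y| <= B -> y * g.[w] = 1 ->
    `|f.[w]| ^+ (size g).-1 <= M * `|g.[w]| ^+ (size f).-1.
Proof.
move=> g0 B0; have [W [K [W1 K0 HK]]] := poly_growth_ge g0.
have W0 : 0 <= W by exact: le_trans W1.
have [L L0 HL] := poly_growth_le f.
have [N N0 HN] := poly_bounded_on_disc f W0.
set a := (size f).-1; set b := (size g).-1.
exists (L ^+ b * K ^+ a + N ^+ b * B ^+ a) => [|y w yB yg].
  by rewrite addr_ge0 // mulr_ge0 // exprn_ge0.
(* The first term of the constant serves for large w, the second for w in the
   disc of radius W. *)
rewrite mulrDl; have [wW|Ww] := real_leP (normr_real w) (ger0_real W0).
  rewrite ler_wpDl ?mulr_ge0 ?exprn_ge0 //.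
  apply: (@le_trans _ _ (N ^+ b)); first by rewrite lerXn2r ?nnegrE // HN.
  rewrite -mulrA -[X in X <= _]mulr1 ler_wpM2l ?exprn_ge0 // -exprMn.
  rewrite exprn_ege1 // -(normr1 C) -yg normrM ler_wpM2r //.
rewrite ler_wpDr ?mulr_ge0 ?exprn_ge0 // -mulrA -exprMn.
have w1 : 1 <= `|w| by rewrite (le_trans W1) // ltW.
apply: (@le_trans _ _ ((L * `|w| ^+ a) ^+ b)).
  by rewrite lerXn2r ?nnegrE ?mulr_ge0 ?exprn_ge0 // HL.
rewrite [X in X <= _]exprMn ler_wpM2l ?exprn_ge0 // -exprM mulnC exprM.
by rewrite lerXn2r ?nnegrE ?mulr_ge0 ?exprn_ge0 // HK // ltW.
Qed.

(** * Divisibility from bounds *)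

Lemma nonroot_near (C : numFieldType) (l : {poly C}) (x e : C) :
  l != 0 -> 0 < e -> exists z, `|z - x| <= e /\ l.[z] != 0.
Proof.
move=> l0 e0; pose z i : C := x + e / i.+1%:R.
have zinj : injective z.
  move=> i j /addrI /(mulfI (lt0r_neq0 e0)) /invr_inj /eqP.
  by rewrite eqr_nat eqSS => /eqP.
(* More of the points x + e / (i + 1) than l can have roots. *)
have [/hasP[y /mapP[i _ ->] ly]|] :=
  boolP (has (predC (root l)) (mkseq z (size l))).
  exists (z i); split=> //; rewrite /z addrC addKr.
  have e_ge0 := ltW e0.
  by rewrite ger0_norm ?divr_ge0 // ler_pdivrMr ?ltr0n // ler_peMr // ler1n.
rewrite has_predC negbK => H.
by have := max_poly_roots l0 H (mkseq_uniq (size l) zinj);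
   rewrite size_mkseq ltnn.
Qed.

(** Continuity of f at x, with an explicit modulus: f(x) differs from f(z) by
    h(z) (z - x), where h = (f - f(x)) / (X - x) is bounded near x.  Excluding
    the roots of l is harmless, since x is a limit of points outside them. *)
Lemma root_of_linear_bound (C : numFieldType) (f l : {poly C}) (x M : C) :
  l != 0 -> 0 <= M ->
  (forall z, `|z - x| <= 1 -> l.[z] != 0 -> `|f.[z]| <= M * `|z - x|) ->
  root f x.
Proof.
move=> l0 M0 H; apply/negPn/negP => fx.
have /factor_theorem [h Eh] : root (f - f.[x]%:P) x.
  by rewrite rootE hornerD hornerN hornerC subrr.
have [N N0 HN] := poly_bounded_on_disc h (addr_ge0 ler01 (normr_ge0 x)).
(* At distance e from x the bound (M + N) |z - x| is already less than
   |f(x)|. *)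
pose S := M + N + 1; have S0 : 0 < S by rewrite ltr_wpDl // addr_ge0.
have k0 : 0 < `|f.[x]| by rewrite normr_gt0.
pose e := `|f.[x]| / (S + `|f.[x]|).
have D0 : 0 < S + `|f.[x]| by rewrite addr_gt0.
have e0 : 0 < e by rewrite divr_gt0.
have e1 : e <= 1 by rewrite ler_pdivrMr // mul1r lerDr ltW.
have [z [zx lz]] := nonroot_near x l0 e0.
have zx1 := le_trans zx e1.
have: `|f.[x]| <= (M + N) * `|z - x|.
  have -> : f.[x] = f.[z] - h.[z] * (z - x).
    rewrite -(hornerXsubC x z) -hornerM -Eh hornerD hornerN hornerC.
    by rewrite opprB addrC subrK.
  rewrite (le_trans (ler_normB _ _)) // mulrDl lerD ?H // normrM ler_wpM2r //.
  rewrite HN // -[z](subrK x) (le_trans (ler_normD _ _)) //.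
  by rewrite lerD2r.
apply/negP; rewrite -real_ltNge ?realM ?realD ?normr_real ?ger0_real //.
apply: (@le_lt_trans _ _ ((M + N) * e)); first by rewrite ler_wpM2l ?addr_ge0.
rewrite /e mulrCA -[X in _ < X]mulr1 ltr_pM2l // ltr_pdivrMr // mul1r.
by rewrite /S -[X in X < _]addr0 -[X in _ < X]addrA ltrD2l addr_gt0.
Qed.

(** A rational function f / g that is bounded on bounded sets has no pole.  Each
    root of g is a root of f and is divided out from both; multiplying l by the
    same linear factor records that the bound is lost at that point, which is
    why finitely many exceptional points are allowed. *)
Lemma dvdp_of_bound (C : numClosedFieldType) (g : {poly C}) :
  g != 0 -> forall f l : {poly C}, l != 0 ->
  (forall B, 0 <= B -> exists2 M, 0 <= M &
     forall z, `|z| <= B -> l.[z] != 0 -> `|f.[z]| <= M * `|g.[z]|) ->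
  g %| f.
Proof.
move: {-1}(size g) (erefl (size g)) => n; elim: n g => [|n IH] g.
  by move/eqP; rewrite size_poly_eq0 => /eqP ->; rewrite eqxx.
move=> sg g0 f l l0 H.
have [sg1|/closed_rootP[x gx]] := eqVneq (size g) 1%N.
  by apply: dvdUp; rewrite -size_poly_eq1 sg1.
have [g1 Eg] := factor_theorem _ _ gx.
have X0 := polyXsubC_eq0 x.
have fx : root f x.
  have B0 := addr_ge0 ler01 (normr_ge0 x).
  have [M M0 HM] := H _ B0; have [N N0 HN] := poly_bounded_on_disc g1 B0.
  apply: (root_of_linear_bound l0 (mulr_ge0 M0 N0)) => z zx lz.
  have zB : `|z| <= 1 + `|x|.
    by rewrite -[z](subrK x) (le_trans (ler_normD _ _)) // lerD2r.
  rewrite (le_trans (HM z zB lz)) // Eg hornerM hornerXsubC normrM mulrA.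
  by rewrite ler_wpM2r // ler_wpM2l // HN.
have [f1 Ef] := factor_theorem _ _ fx.
rewrite Eg Ef dvdp_mul2r ?X0 //.
have g10 : g1 != 0 by apply: contraNneq g0 => g10; rewrite Eg g10 mul0r.
apply: (IH _ _ g10 _ (l * ('X - x%:P))); last 1 first.
- move=> B /H [M M0 HM]; exists M => // z zB.
  rewrite hornerM hornerXsubC mulf_eq0 negb_or => /andP[lz zx].
  have := HM z zB lz; rewrite Eg Ef !hornerM hornerXsubC !normrM mulrA.
  by rewrite ler_pM2r // normr_gt0.
- apply: succn_inj.
  by rewrite -sg Eg size_Mmonic ?monicXsubC // size_XsubC addn2.
- by rewrite mulf_neq0 // X0.
Qed.

(** * Polynomials on the common zero set *)

(** Since p(z) q'(w) = q(z) p'(w) = 1, the quotient p^a / q^b at z equals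
    p'^b / q'^a at w, which [ratio_bound] controls when z is bounded. *)
Lemma dvdp_of_curve (C : numClosedFieldType) (p q p' q' l : {poly C}) :
  size p' = size p -> size q' = size q -> l != 0 ->
  (forall z, l.[z] != 0 ->
     exists w, p.[z] * q'.[w] = 1 /\ q.[z] * p'.[w] = 1) ->
  q ^+ (size q).-1 %| p ^+ (size p).-1.
Proof.
move=> sp sq l0 H.
have [z0 [_ /H[w0 [pq qp]]]] := nonroot_near 0 l0 ltr01.
have q0 : q != 0.
  by apply: contra_eq_neq qp => ->; rewrite horner0 mul0r eq_sym oner_neq0.
have q'0 : q' != 0 by rewrite -size_poly_eq0 sq size_poly_eq0.
apply: (dvdp_of_bound (expf_neq0 _ q0) l0) => B B0.
have [B' B'0 HB'] := poly_bounded_on_disc p B0.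
have [M M0 HM] := ratio_bound p' q'0 B'0.
exists M => // z zB /H[w [Epq Eqp]].
have := HM _ _ (HB' z zB) Epq; rewrite sp sq !horner_exp !normrX.
set a := (size p).-1; set b := (size q).-1 => le_w.
have Ea : `|p.[z]| ^+ a * `|q'.[w]| ^+ a = 1.
  by rewrite -exprMn -normrM Epq normr1 expr1n.
have Eb : `|q.[z]| ^+ b * `|p'.[w]| ^+ b = 1.
  by rewrite -exprMn -normrM Eqp normr1 expr1n.
(* Multiplied by 1 = |q|^b |p'|^b on the left and by 1 = |p|^a |q'|^a on the
   right, the goal becomes [le_w] times |p|^a |q|^b. *)
rewrite -[X in X <= _]mulr1 -Eb -[X in _ <= X]mulr1 -Ea.
rewrite [X in X <= _]mulrCA [M * _]mulrC [X in _ <= X]mulrACA -mulrA.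
by rewrite !ler_wpM2l ?exprn_ge0.
Qed.

(** The hypotheses are invariant under exchanging p and q, so both
    divisibilities hold and p^a, q^b are associate; comparing degrees gives
    a^2 = b^2. *)
Lemma proportional_of_curve (C : numClosedFieldType) (p q p' q' l : {poly C}) :
  size p' = size p -> size q' = size q -> l != 0 ->
  (forall z, l.[z] != 0 ->
     exists w, p.[z] * q'.[w] = 1 /\ q.[z] * p'.[w] = 1) ->
  p %= q.
Proof.
move=> sp sq l0 H.
have dqp := dvdp_of_curve sp sq l0 H.
have dpq : p ^+ (size p).-1 %| q ^+ (size q).-1.
  by apply: (dvdp_of_curve sq sp l0) => z /H[w []]; exists w.
have E : p ^+ (size p).-1 %= q ^+ (size q).-1 by rewrite /eqp dpq.
have [z0 [_ /H[w0 [pq qp]]]] := nonroot_near 0 l0 ltr01.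
have p0 : p != 0.
  by apply: contra_eq_neq pq => ->; rewrite horner0 mul0r eq_sym oner_neq0.
have q0 : q != 0.
  by apply: contra_eq_neq qp => ->; rewrite horner0 mul0r eq_sym oner_neq0.
have Ed : (size p).-1 = (size q).-1.
  apply/eqP; rewrite -(eqn_exp2r _ _ (ltn0Sn 1)) -!mulnn -!size_exp.
  by rewrite (eqp_size E).
(* For a = b = 0 the powers carry no information, but then p and q are nonzero
   constants. *)
have [d0|d0] := posnP (size p).-1; last first.
  by move: E; rewrite -Ed /eqp !dvdp_pexp2r.
have sz1 (f : {poly C}) : f != 0 -> (size f).-1 = 0%N -> f %= 1.
  by rewrite -size_poly_gt0 -size_poly_eq1; case: size => // n _ /= ->.
by rewrite (eqp_trans (sz1 p p0 d0)) // eqp_sym sz1 // -Ed.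
Qed.

Lemma eqp_scale (C : fieldType) (p q : {poly C}) :
  p %= q -> exists c, p = c *: q.
Proof.
move=> /eqpP[[c d] /andP[/= c0 d0] E]; exists (c^-1 * d).
by rewrite -scalerA -E scalerA mulVf // scale1r.
Qed.

(** In {poly {poly C}} the inner variable is z and the outer one is w.  If w
    occurs in e, then e(z, .) has a root for each z at which the leading
    coefficient does not vanish; otherwise e is a polynomial in z alone, whose
    zero set is empty or contains a vertical line. *)
Lemma bipoly_zeros (C : closedFieldType) (e : {poly {poly C}}) :
  [\/ exists2 c, c != 0 & e = c%:P%:P,
      exists x, forall w, e.[w%:P].[x] = 0
    | exists2 l : {poly C}, l != 0 &
        forall z, l.[z] != 0 -> exists w, e.[w%:P].[z] = 0].
Proof.
have [/size1_polyC ->|se] := leqP (size e) 1.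
  set d := e`_0; have [/eqP/size_poly1P[c c0 ->]|] := eqVneq (size d) 1%N.
    by apply: Or31; exists c.
  move=> /closed_rootP[x dx]; apply: Or32; exists x => w.
  by rewrite hornerC; apply/eqP.
apply: Or33; exists (lead_coef e) => [|z ez].
  by rewrite lead_coef_eq0 -size_poly_gt0 ltnW.
have sz : size (map_poly (horner_eval z) e) = size e.
  by apply: size_map_poly_id0.
have : size (map_poly (horner_eval z) e) != 1%N by rewrite sz gtn_eqF.
move=> /closed_rootP[w /eqP ew]; exists w.
by rewrite -/(horner_eval z _) -horner_map /= /horner_eval hornerC.
Qed.

(** * From C[z_1, z_2] to C[z][w] *)

Definition bivar (C : comNzRingType) (i : 'I_2) : {poly {poly C}} :=
  if i == 0 then 'X%:P else 'X.

Definition to_bipoly (C : comNzRingType) : {mpoly C[2]} -> {poly {poly C}} :=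
  mmap (polyC \o polyC) (@bivar C).

(** Evaluation of the coefficients at z_1, then of the outer variable at z_2. *)
Definition of_bipoly (C : comNzRingType) : {poly {poly C}} -> {mpoly C[2]} :=
  horner_eval 'X_1 \o map_poly (horner_eval 'X_0 \o map_poly (@mpolyC 2 C)).

HB.instance Definition _ (C : comNzRingType) :=
  GRing.RMorphism.copy (@to_bipoly C) (mmap (polyC \o polyC) (@bivar C)).

HB.instance Definition _ (C : comNzRingType) :=
  GRing.RMorphism.copy (@of_bipoly C)
    (horner_eval 'X_1 \o map_poly (horner_eval 'X_0 \o map_poly (@mpolyC 2 C))).

Lemma of_bipolyC (C : comNzRingType) (c : C) : of_bipoly c%:P%:P = c%:MP.
Proof.
by rewrite /of_bipoly /= map_polyC /= /horner_eval hornerC map_polyC hornerC.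
Qed.

(** Injectivity is what lets a constant image come only from a constant. *)
Lemma to_bipolyK (C : comNzRingType) : cancel (@to_bipoly C) (@of_bipoly C).
Proof.
move=> D; rewrite [RHS]mpolyE /to_bipoly /mmap rmorph_sum.
apply: eq_bigr => m _.
rewrite rmorphM /= of_bipolyC -mul_mpolyC mpolyXE_id; congr (_ * _).
rewrite rmorph_prod; apply: eq_bigr => i _; rewrite rmorphXn; congr (_ ^+ _).
rewrite /bivar; case: eqVneq => [->|i0]; rewrite /= /of_bipoly /=.
  by rewrite map_polyC /= /horner_eval hornerC map_polyX hornerX.
by rewrite map_polyX /horner_eval hornerX; case: i i0 => [[|[|[]]] ?] // _;
   congr 'X_ _; apply: val_inj.
Qed.

Lemma to_bipolyC (C : comNzRingType) (c : C) : to_bipoly c%:MP = c%:P%:P.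
Proof. exact: mmapC. Qed.

Lemma to_bipolyX (C : comNzRingType) (i : 'I_2) :
  to_bipoly 'X_i = @bivar C i.
Proof. by rewrite /to_bipoly mmapX mmap1U. Qed.

Lemma to_bipolyM (C : comNzRingType) (A B : {mpoly C[2]}) :
  to_bipoly (A * B) = to_bipoly A * to_bipoly B.
Proof. exact: rmorphM. Qed.

Lemma to_bipolyB1 (C : comNzRingType) (A : {mpoly C[2]}) :
  to_bipoly (A - 1) = to_bipoly A - 1.
Proof.
have to1 : to_bipoly (1 : {mpoly C[2]}) = 1 by exact: rmorph1.
by rewrite -to1; apply: mmapB.
Qed.

Lemma to_bipoly_sum0 (C : comNzRingType) n (a : nat -> C) :
  to_bipoly (\sum_(k < n) a k *: 'X_0 ^+ k) = (\sum_(k < n) a k *: 'X^k)%:P.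
Proof.
rewrite !rmorph_sum; apply: eq_bigr => k _ /=.
by rewrite -mul_mpolyC -mul_polyC !rmorphM !rmorphXn /= to_bipolyC to_bipolyX.
Qed.

Lemma to_bipoly_sum1 (C : comNzRingType) n (a : nat -> C) :
  to_bipoly (\sum_(k < n) a k *: 'X_1 ^+ k)
  = map_poly polyC (\sum_(k < n) a k *: 'X^k).
Proof.
rewrite !rmorph_sum; apply: eq_bigr => k _ /=.
rewrite -mul_mpolyC -mul_polyC !rmorphM !rmorphXn /= to_bipolyC to_bipolyX.
by rewrite map_polyC map_polyX.
Qed.

Lemma to_bipoly_z (R : realType) (p : {poly R[i]}) :
  to_bipoly (poly_z p) = p%:P.
Proof. by rewrite -[in RHS](coefK p) poly_def -to_bipoly_sum0. Qed.

Lemma to_bipoly_zbar (R : realType) (p : {poly R[i]}) :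
  to_bipoly (poly_zbar p) = map_poly polyC (map_poly Num.conj p).
Proof.
rewrite {2}/map_poly poly_def.
exact: (to_bipoly_sum1 _ (fun k => (p`_k)^*)).
Qed.

(** * Common factors *)

(** Evaluated at a zero of D, the two factorizations become the equations
    p(z) q'(w) = q(z) p'(w) = 1, and any zero set that is not empty makes p
    and q proportional. *)
Lemma msize_common_factor (C : numClosedFieldType) (p q : {poly C})
    (pz pzbar qz qzbar D P1 Q1 : {mpoly C[2]}) :
  to_bipoly pz = p%:P -> to_bipoly qz = q%:P ->
  to_bipoly pzbar = map_poly polyC (map_poly Num.conj p) ->
  to_bipoly qzbar = map_poly polyC (map_poly Num.conj q) ->
  pz * qzbar - 1 = D * P1 -> pzbar * qz - 1 = D * Q1 ->
  msize D = 1%N \/ p %= q.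
Proof.
move=> Epz Eqz Epzbar Eqzbar.
move=> /(congr1 (@to_bipoly _)) EP /(congr1 (@to_bipoly _)) EQ.
move: EP EQ; rewrite !to_bipolyB1 !to_bipolyM Epz Eqz Epzbar Eqzbar.
set p' := map_poly Num.conj p; set q' := map_poly Num.conj q.
set e := to_bipoly D => EP EQ.
have sp : size p' = size p by exact: size_map_poly.
have sq : size q' = size q by exact: size_map_poly.
have zero z w : e.[w%:P].[z] = 0 -> p.[z] * q'.[w] = 1 /\ q.[z] * p'.[w] = 1.
  have evC (f : {poly C}) : (map_poly polyC f).[w%:P].[z] = f.[w].
    by rewrite horner_map hornerC.
  move=> e0; split; apply/eqP; rewrite -subr_eq0 -evC.
    have := congr1 (fun f => f.[w%:P].[z]) EP; rewrite !hornerE.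
    by rewrite e0 mul0r => ->.
  have := congr1 (fun f => f.[w%:P].[z]) EQ; rewrite !hornerE.
  by rewrite e0 mul0r mulrC => ->.
have [[c c0 ec]|[x Hx]|[l l0 Hl]] := bipoly_zeros e.
- left; rewrite -[D]to_bipolyK -/e ec of_bipolyC.
  by rewrite msizeC c0.
(* The line z = x: here w is the free variable and x is its companion point, so
   the roles of (p, q) and (q', p') are exchanged. *)
- right.
  rewrite -(eqp_map Num.conj).
  apply: (proportional_of_curve (esym sp) (esym sq) (oner_neq0 _)) => w _.
  by exists x; have [] := zero x w (Hx w); rewrite ![_.[w] * _]mulrC.
- right.
  apply: (proportional_of_curve sp sq l0) => z /Hl[w ew]; exists w.
  exact: zero.
Qed.

Theorem lemma1p6 (R : realType) (p q : {poly R[i]})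
  (hpq : ~ exists c : R[i], p = c *: q) :
  mcoprime (poly_z p * poly_zbar q - 1) (poly_zbar p * poly_z q - 1).
Proof.
move=> D P1 Q1 EP EQ.
have [//|/eqp_scale/hpq[]] := msize_common_factor (to_bipoly_z p)
  (to_bipoly_z q) (to_bipoly_zbar p) (to_bipoly_zbar q) EP EQ.
Qed.
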